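(* Let $r$ and $s$ be positive integers with $r\geq 2s-2$, and let $G$ be a finite simple graph of order $n=3r+4s$ with $\sigma_{2}(G)\geq n+r$. Then $G$ contains $r$ triangles and $s$ quadrilaterals, all pairwise vertex-disjoint (i.e. $G\supseteq rC_{3}\cup sC_{4}$).
   Context: All graphs are finite, simple and undirected. For a graph $G$, $\sigma_{2}(G)=\min\{d(x)+d(y): x,y\in V(G),\ x\neq y,\ xy\notin E(G)\}$, where $d(v)$ is the degree of $v$; if $G$ is complete, $\sigma_2(G)=\infty$. $C_3$ is a triangle (cycle on 3 vertices) and $C_4$ a quadrilateral (cycle on 4 vertices); $rC_3\cup sC_4$ denotes $r+s$ vertex-disjoint cycles, $r$ of length 3 and $s$ of length 4, and containment means as (not necessarily induced) subgraphs. *)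

(* Defs.v *)
From mathcomp Require Import all_boot.
Set Implicit Arguments. Unset Strict Implicit. Unset Printing Implicit Defensive.

Definition simple_graph (T : finType) (e : rel T) : Prop :=
  symmetric e /\ irreflexive e.

Definition deg (T : finType) (e : rel T) (x : T) : nat := #|[set y | e x y]|.

(* sigma_2(G) >= k : every pair of distinct non-adjacent vertices has degree sum >= k
   (vacuous when G is complete, matching sigma_2 = infinity). *)
Definition sigma2_ge (T : finType) (e : rel T) (k : nat) : Prop :=
  forall x y : T, x != y -> ~~ e x y -> k <= deg e x + deg e y.

(* G contains r C_3 \cup s C_4: an injective labelling of the vertices of
   r disjoint triangles and s disjoint quadrilaterals such that consecutive
   vertices on each cycle are adjacent in G. Injectivity = vertex-disjointness
   and distinct vertices on each cycle. *)
Definition contains_rC3_sC4 (T : finType) (e : rel T) (r s : nat) : Prop :=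
  exists f : ('I_r * 'I_3) + ('I_s * 'I_4) -> T,
    injective f /\
    (forall (i : 'I_r) (j : 'I_3), e (f (inl (i, j))) (f (inl (i, ordS j)))) /\
    (forall (i : 'I_s) (j : 'I_4), e (f (inr (i, j))) (f (inr (i, ordS j)))).

(* Main.v *)
Require Import Defs.
From mathcomp Require Import all_boot zify.

(* Write k = r + s, so that sigma_2 >= 4k.  Adding a nonedge of G keeps the
   hypothesis, so by induction on the number of nonedges G + xy has the required
   factor; hence G has it, or it splits into r triangles, s - 1 quadrilaterals
   and a path on 4 vertices, or into r - 1 triangles, s quadrilaterals and a
   path on 3 vertices (a cherry).  In each defective case a weighted degree sum
   over nonadjacent vertices of the defective part exceeds what the other parts
   may receive on average, so some part receives many edges, and regrouping the
   vertices of both parts improves the situation: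
   cherry -> path on 4 vertices -> paw -> factor.
   For the paw, a triangle can absorb weight 6 and a quadrilateral weight 12,
   against an average of 8; this is where r >= 2s - 2 is used.  The regroupings
   concern at most 9 vertices and are checked by computation. *)

Set Implicit Arguments.
Unset Strict Implicit.
Unset Printing Implicit Defensive.

(** * Patterns and the computational check of regroupings *)

(* Edges of a graph on the positions of a sequence of vertices. *)
Definition pattern := seq (nat * nat).
Definition triangle : pattern := [:: (0, 1); (1, 2); (2, 0)].
Definition square : pattern := [:: (0, 1); (1, 2); (2, 3); (3, 0)].
Definition cherry : pattern := [:: (0, 2); (1, 2)].
Definition path4 : pattern := [:: (0, 1); (1, 2); (2, 3)].
Definition paw : pattern := [:: (0, 1); (0, 2); (1, 2); (2, 3)].
Definition shift (k : nat) (P : pattern) : pattern :=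
  [seq (ij.1 + k, ij.2 + k) | ij <- P].
(** A cherry with ends 0, 1 and centre 2, next to a triangle on 3, 4, 5. Of the six edges between
    the ends and the triangle only 1-5 may be missing. It arises when a triangle receives at least
    five edges from the ends of a cherry. *)
Definition bowl : pattern :=
  cherry ++ shift 3 triangle ++ [:: (0, 3); (0, 4); (0, 5); (1, 3); (1, 4)].
Definition bounded (n : nat) (P : pattern) : bool :=
  all (fun ij => (ij.1 < n) && (ij.2 < n)) P.
(** The outer index runs over [J], so the edges come grouped by their end in [J], in step with the
    repeated weight list of [exchange_check]. *)
Definition cross (I J : seq nat) : pattern := [seq (i, j) | j <- J, i <- I].

Definition weight (w : seq nat) (m : seq bool) : nat :=
  sumn [seq x.1 * nat_of_bool x.2 | x <- zip w m].

(** Each missing entry is paid for out of the budget [d], so masks over budget are cut off early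
    instead of being generated and filtered. *)
Fixpoint all_masks (w : seq nat) (d : nat) (k : seq bool -> bool) : bool :=
  if w is c :: w' then
    all_masks w' d (fun m => k (true :: m)) &&
    (if c <= d then all_masks w' (d - c) (fun m => k (false :: m)) else true)
  else k [::].

Lemma all_masksP w d k m :
  all_masks w d k -> size m = size w -> sumn w <= weight w m + d -> k m.
Proof.
rewrite /weight.
elim: w d k m => [|c w IH] d k [|b m] //= /andP[kt kf] [sz].
(* If the head entry is missing, the tail contributes at most [sumn w], so [d] must cover all of
   [c]. *)
have le_w : weight w m <= sumn w.
  rewrite /weight; elim: (w) m sz {IH kt kf} => [|c' w' IH'] [|b' m'] //= [/IH'].
  by case: b'; lia.
rewrite /weight in le_w; case: b => /= le_d.
  by apply: (IH d (fun m => k (true :: m))) => //; lia.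
have cd : c <= d by lia.
by rewrite cd /= in kf; apply: (IH _ (fun m => k (false :: m))) kf sz _; lia.
Qed.

Lemma weight_cat w1 w2 m1 m2 : size m1 = size w1 ->
  weight (w1 ++ w2) (m1 ++ m2) = weight w1 m1 + weight w2 m2.
Proof. by move=> sz; rewrite /weight zip_cat // map_cat sumn_cat. Qed.

Definition mem_edge (E : pattern) (uv : nat * nat) : bool :=
  (uv \in E) || ((uv.2, uv.1) \in E).
Definition image (p : seq nat) (Q : pattern) : pattern :=
  [seq (nth 0 p ij.1, nth 0 p ij.2) | ij <- Q].
Definition needs (V Q : pattern) (p : seq nat) : seq bool :=
  [seq mem_edge (image p Q) v | v <- V].
Definition covers (m q : seq bool) : bool :=
  all (fun x => x.1 ==> x.2) (zip q m).

(* [K] lists target patterns [Q], each with some reorderings [p] of the [n]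
   vertices.  The edges [F] are present, and so are those of [V] except for
   some of total weight at most [d].  Whichever edges of [V] are missing, one
   of the reorderings must exhibit its target. *)
Definition regroup_check (n : nat) (F V : pattern) (w : seq nat) (d : nat)
    (K : seq (pattern * seq (seq nat))) : bool :=
  [&& size V == size w,
      all (fun Qps => bounded n Qps.1 &&
        all (fun p => perm_eq p (iota 0 n) &&
                      all (mem_edge (F ++ V)) (image p Qps.1)) Qps.2) K &
      let N := flatten [seq [seq needs V Qps.1 p | p <- Qps.2] | Qps <- K] in
      all_masks w d (fun m => has (covers m) N)].

(** The defective part has positions below [h], the other part the next [c]. A part receiving weight
    more than [a] lacks at most the full weight [c * sumn cs] minus [a.+1], which is the budget. *)
Definition exchange_check (h c : nat) (FH FC : pattern) (I cs : seq nat)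
    (a : nat) (K : seq (pattern * seq (seq nat))) : bool :=
  [&& bounded h FH, size I == size cs, all (fun i => i < h) I &
  regroup_check (h + c) (FH ++ shift h FC) (cross I (iota h c))
    (flatten (nseq c cs)) (c * sumn cs - a.+1) K].

(* The reorderings in the following tables were found by computer search. *)
Lemma paw_triangle_check :
  exchange_check 4 3 paw triangle [:: 0; 1; 3] [:: 1; 1; 2] 6
  [:: (triangle ++ shift 3 square,
    [:: [:: 0;1;2;3;4;5;6]; [:: 0;1;2;3;4;6;5]; [:: 0;1;2;3;5;4;6];
        [:: 0;4;5;1;2;3;6]; [:: 0;4;6;1;2;3;5]; [:: 0;5;6;1;2;3;4];
        [:: 1;4;5;0;2;3;6]; [:: 1;4;6;0;2;3;5]; [:: 1;5;6;0;2;3;4]])].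
Proof. by vm_compute. Qed.

Lemma paw_square_check :
  exchange_check 4 4 paw square [:: 0; 1; 3] [:: 1; 1; 2] 12
  [:: (square ++ shift 4 square,
    [:: [:: 0;2;1;4;3;5;6;7]; [:: 0;2;1;5;3;4;7;6];
        [:: 0;2;1;6;3;5;4;7]; [:: 0;2;1;7;3;4;5;6]])].
Proof. by vm_compute. Qed.

Lemma path4_triangle_check :
  exchange_check 4 3 path4 triangle [:: 0; 1; 2; 3] [:: 1; 1; 1; 1] 7
  [:: (triangle ++ shift 3 paw,
    [:: [:: 0;1;5;2;3;4;6]; [:: 0;1;6;4;5;2;3]; [:: 0;4;5;3;6;2;1];
        [:: 3;4;5;2;6;1;0]; [:: 2;3;6;4;5;1;0]; [:: 3;4;6;2;5;1;0];
        [:: 3;5;6;2;4;1;0]; [:: 0;1;4;5;6;2;3]; [:: 0;1;5;4;6;2;3];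
        [:: 0;1;6;2;3;4;5]; [:: 0;1;6;2;3;5;4]; [:: 0;4;5;1;6;2;3];
        [:: 0;4;6;1;5;2;3]]);
      (triangle ++ shift 3 square,
    [:: [:: 0;4;6;1;2;3;5]; [:: 0;5;6;1;2;3;4]; [:: 0;4;5;1;2;3;6];
        [:: 3;4;5;0;1;2;6]; [:: 3;4;6;0;1;2;5]; [:: 2;3;5;0;1;6;4]])].
Proof. by vm_compute. Qed.

Lemma path4_square_check :
  exchange_check 4 4 path4 square [:: 0; 1; 2; 3] [:: 1; 1; 1; 1] 10
  [:: (square ++ shift 4 paw,
    [:: [:: 0;1;2;4;3;5;6;7]; [:: 0;1;2;5;3;4;7;6]; [:: 0;1;4;5;6;7;2;3];
        [:: 1;2;3;5;0;6;7;4]; [:: 2;3;4;5;6;7;1;0]; [:: 2;3;7;4;0;1;6;5];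
        [:: 0;1;5;4;2;3;6;7]; [:: 0;4;5;6;1;7;2;3]; [:: 2;3;5;4;0;1;7;6];
        [:: 2;3;4;7;5;6;1;0]; [:: 1;2;3;7;0;4;5;6]; [:: 2;3;7;6;4;5;1;0];
        [:: 0;1;2;6;3;5;4;7]; [:: 2;3;6;7;0;1;5;4]; [:: 0;1;6;7;2;3;4;5];
        [:: 0;1;7;6;4;5;2;3]; [:: 0;1;6;5;2;3;7;4]; [:: 0;1;2;7;3;4;5;6]]);
      (square ++ shift 4 square, [:: [:: 0;1;4;7;2;3;6;5]])].
Proof. by vm_compute. Qed.

(** Some end is adjacent to two consecutive vertices of the quadrilateral and the other end to one
    of the remaining two. The first end closes a triangle; the centre, the other end and the
    remaining two vertices form the path. *)
Lemma cherry_square_check :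
  exchange_check 3 4 cherry square [:: 0; 1] [:: 1; 1] 4
  [:: (triangle ++ shift 3 path4,
    [:: [:: 0;3;4;2;1;5;6]; [:: 0;5;6;2;1;3;4]; [:: 0;3;6;2;1;4;5];
        [:: 0;4;5;2;1;6;3]; [:: 1;3;4;2;0;5;6]; [:: 1;3;6;2;0;4;5];
        [:: 1;4;5;2;0;6;3]; [:: 1;5;6;2;0;3;4]])].
Proof. by vm_compute. Qed.

Lemma cherry_triangle_check :
  exchange_check 3 3 cherry triangle [:: 0; 1] [:: 1; 1] 4
  [:: (bowl,
    [:: [:: 0;1;2;3;4;5]; [:: 0;1;2;3;5;4]; [:: 0;1;2;4;5;3];
        [:: 1;0;2;3;4;5]; [:: 1;0;2;3;5;4]; [:: 1;0;2;4;5;3]])].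
Proof. by vm_compute. Qed.

Lemma bowl_triangle_check :
  exchange_check 6 3 bowl triangle [:: 0; 1; 2; 5] [:: 1; 1; 2; 2] 12
  [:: (triangle ++ shift 3 (triangle ++ shift 3 triangle),
    [:: [:: 0;2;6;1;3;4;5;7;8]; [:: 0;2;7;1;3;4;5;6;8];
        [:: 0;5;6;1;3;4;2;7;8]; [:: 0;5;7;1;3;4;2;6;8];
        [:: 0;5;8;1;3;4;2;6;7]; [:: 0;3;4;1;2;6;5;7;8];
        [:: 0;2;7;1;6;8;3;4;5]; [:: 0;3;4;1;2;7;5;6;8];
        [:: 0;2;8;1;6;7;3;4;5]; [:: 0;3;4;1;2;8;5;6;7];
        [:: 0;6;7;1;2;8;3;4;5]; [:: 0;6;8;1;2;7;3;4;5]])].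
Proof. by vm_compute. Qed.

(** * Regroupings inside a graph *)

Section Graph.

Variables (T : finType) (e : rel T) (x0 : T).
Hypotheses (e_sym : symmetric e) (e_irr : irreflexive e).

Definition edge_at (l : seq T) (ij : nat * nat) : bool :=
  e (nth x0 l ij.1) (nth x0 l ij.2).
Definition edges_at (l : seq T) (P : pattern) : bool := all (edge_at l) P.

Lemma edges_at_cat l P k Q :
  edges_at l (P ++ shift k Q) = edges_at l P && edges_at (drop k l) Q.
Proof.
rewrite /edges_at all_cat all_map; congr (_ && _).
by apply: eq_all => ij; rewrite /edge_at /= !nth_drop !(addnC k).
Qed.

Lemma edges_at_take l P k :
  bounded k P -> edges_at (take k l) P = edges_at l P.
Proof.
move=> /allP bP; apply: eq_in_all => ij /bP /andP[i1 i2].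
by rewrite /edge_at !nth_take.
Qed.

Lemma perm_reorder l p :
  perm_eq p (iota 0 (size l)) -> perm_eq [seq nth x0 l i | i <- p] l.
Proof.
by move=> pp; rewrite -[X in perm_eq _ X](mkseq_nth x0) perm_map.
Qed.

(** The actual adjacencies on [V] form a mask within the budget, so the enumeration yields a
    reordering whose edges in [V] are all present; its other edges lie in [F]. *)
Lemma regroup n F V w d K l :
  regroup_check n F V w d K -> size l = n -> edges_at l F ->
  sumn w <= weight w [seq edge_at l ij | ij <- V] + d ->
  exists l' Q, [/\ perm_eq l' l, Q \in unzip1 K & edges_at l' Q].
Proof.
case/and3P=> /eqP szV /allP Kok chk szl /allP Fl le_d.
have szm : size [seq edge_at l ij | ij <- V] = size w by rewrite size_map.
have /hasP[q] := all_masksP chk szm le_d.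
case/flattenP=> _ /mapP[[Q ps] QK ->] /mapP[p pps ->{q}] /=.
rewrite /covers zip_map all_map => /allP Vl.
have /andP[/allP bQ /allP/(_ p pps)/andP[pp /allP Qp]] := Kok _ QK.
exists [seq nth x0 l i | i <- p], Q; split.
- by apply: perm_reorder; rewrite szl.
- by apply/mapP; exists (Q, ps).
apply/allP => ij ijQ; have /andP[i1 i2] := bQ _ ijQ.
have szp : size p = n by rewrite (perm_size pp) size_iota.
have im : (nth 0 p ij.1, nth 0 p ij.2) \in image p Q by apply: map_f.
rewrite /edge_at !(nth_map 0) ?szp //.
have := Qp _ im; rewrite /mem_edge !mem_cat /=.
case/orP => /orP[/Fl //|inV]; last 1 first.
- have /implyP := Vl _ inV; rewrite /mem_edge /= im orbT e_sym.
  exact.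
- by have /implyP := Vl _ inV; rewrite /mem_edge /= im; apply.
by rewrite e_sym.
Qed.

Definition wdeg (I cs : seq nat) (H : seq T) (y : T) : nat :=
  weight cs [seq e (nth x0 H i) y | i <- I].

Lemma exchange h c FH FC I cs a K H C :
  exchange_check h c FH FC I cs a K ->
  size H = h -> size C = c -> edges_at H FH -> edges_at C FC ->
  a < \sum_(y <- C) wdeg I cs H y ->
  exists l Q, [/\ perm_eq l (H ++ C), Q \in unzip1 K & edges_at l Q].
Proof.
move=> /and4P[bH /eqP szI /allP ltI chk] szH szC FHl FCl lt_a.
apply: (regroup chk); first by rewrite size_cat szH szC.
  rewrite edges_at_cat -szH drop_size_cat // FCl andbT.
  by rewrite -(@edges_at_take _ _ h) // -szH take_size_cat.
(* The mask of cross edges splits into one block per vertex of [C], so its weight is the sum of the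
   [wdeg] values. *)
have -> : [seq edge_at (H ++ C) ij | ij <- cross I (iota h c)] =
    flatten [seq [seq e (nth x0 H i) y | i <- I] | y <- C].
  have {2}-> : C = [seq nth x0 (H ++ C) j | j <- iota h c].
    rewrite map_nth_iota; last by rewrite size_cat szH szC addKn.
    by rewrite -szH drop_size_cat // -szC take_size.
  rewrite /cross map_allpairs /allpairs_dep -map_comp; congr flatten.
  apply: eq_map => j /=; apply/eq_in_map => i /ltI lti.
  by rewrite /edge_at /= nth_cat szH lti.
have sum_cs n : sumn (flatten (nseq n cs)) = n * sumn cs.
  by elim: n => //= n IHn; rewrite sumn_cat IHn mulSn.
rewrite sum_cs.
suff <- : \sum_(y <- C) wdeg I cs H y =
  weight (flatten (nseq c cs))
    (flatten [seq [seq e (nth x0 H i) y | i <- I] | y <- C]).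
  by lia.
rewrite -{}szC; elim: {lt_a FCl} C => [|y C IHC]; first by rewrite big_nil.
by rewrite big_cons IHC /= weight_cat // size_map.
Qed.

(** * Partial packings by disjoint triangles and quadrilaterals *)

Definition is_triangle t := (size t == 3) && edges_at t triangle.
Definition is_square q := (size q == 4) && edges_at q square.

(* [H] holds the vertices outside the [r] triangles and [s] quadrilaterals. *)
Definition packed (r s : nat) (H : seq T) : Prop :=
  exists ts qs : seq (seq T),
    [/\ size ts = r, size qs = s, all is_triangle ts, all is_square qs
      & perm_eq (H ++ flatten ts ++ flatten qs) (enum T)].

Lemma packed_perm r s H H' : perm_eq H' H -> packed r s H -> packed r s H'.
Proof.
move=> pH [ts [qs [? ? ? ? pE]]]; exists ts, qs; split=> //.
by apply: perm_trans pE; rewrite perm_cat2r.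
Qed.

Lemma packed_uniq r s H : packed r s H -> uniq H.
Proof.
case=> ts [qs [_ _ _ _ pE]]; have := enum_uniq T.
by rewrite -(perm_uniq pE) cat_uniq => /and3P[].
Qed.

Lemma packed_triangle r s t H :
  is_triangle t -> packed r s (t ++ H) -> packed r.+1 s H.
Proof.
move=> tt [ts [qs [rE sE tts tqs pE]]]; exists (t :: ts), qs.
split; rewrite /= ?rE ?tt //; apply: perm_trans pE.
by rewrite -!catA perm_catCA.
Qed.

Lemma packed_square r s q H :
  is_square q -> packed r s (q ++ H) -> packed r s.+1 H.
Proof.
move=> tq [ts [qs [rE sE tts tqs pE]]]; exists ts, (q :: qs).
split; rewrite /= ?sE ?tq //; apply: perm_trans pE.
by rewrite -catA perm_sym perm_catCA perm_cat2l perm_catCA.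
Qed.

(** Targets of the checks list the finished cycle first, so it can be peeled off, leaving the
    improved defective part. *)
Lemma packed_take3 r s l P :
  3 <= size l -> edges_at l (triangle ++ shift 3 P) -> packed r s l ->
  packed r.+1 s (drop 3 l) /\ edges_at (drop 3 l) P.
Proof.
rewrite edges_at_cat => szl /andP[tl Pl] pl; split=> //.
apply: (@packed_triangle _ _ (take 3 l)); last by rewrite cat_take_drop.
by rewrite /is_triangle size_takel // edges_at_take.
Qed.

Lemma packed_take4 r s l P :
  4 <= size l -> edges_at l (square ++ shift 4 P) -> packed r s l ->
  packed r s.+1 (drop 4 l) /\ edges_at (drop 4 l) P.
Proof.
rewrite edges_at_cat => szl /andP[tl Pl] pl; split=> //.
apply: (@packed_square _ _ (take 4 l)); last by rewrite cat_take_drop.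
by rewrite /is_square size_takel // edges_at_take.
Qed.

Lemma packed_triangle_nil r s l :
  size l = 3 -> edges_at l triangle -> packed r s l -> packed r.+1 s [::].
Proof.
move=> szl tl pl; apply: (@packed_triangle _ _ l); last by rewrite cats0.
by rewrite /is_triangle szl.
Qed.

Lemma packed_square_nil r s l :
  size l = 4 -> edges_at l square -> packed r s l -> packed r s.+1 [::].
Proof.
move=> szl tl pl; apply: (@packed_square _ _ l); last by rewrite cats0.
by rewrite /is_square szl.
Qed.

(** * Averaging over the parts of a packing *)

Lemma sum_flatten (W : T -> nat) (ls : seq (seq T)) B :
  {in ls, forall l, \sum_(y <- l) W y <= B} ->
  \sum_(y <- flatten ls) W y <= size ls * B.
Proof.
elim: ls => [|l ls IH] le_B /=; first by rewrite big_nil.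
rewrite big_cat mulSn leq_add ?le_B ?mem_head ?IH // => l' l'ls.
by apply: le_B; rewrite inE l'ls orbT.
Qed.

(** Pigeonhole: if each triangle had weight at most [A] and each quadrilateral at most [B], the
    total would be too small. The heavy part found is released next to [H], ready for an
    exchange. *)
Lemma packed_average (W : T -> nat) A B r s H :
  packed r s H -> \sum_(y <- H) W y + r * A + s * B < \sum_y W y ->
  (exists r' t, [/\ r = r'.+1, is_triangle t, A < \sum_(y <- t) W y
                  & packed r' s (H ++ t)]) \/
  (exists s' q, [/\ s = s'.+1, is_square q, B < \sum_(y <- q) W y
                  & packed r s' (H ++ q)]).
Proof.
case=> ts [qs [rE sE tts tqs pE]] lt_sum.
case: (boolP (has (fun t => A < \sum_(y <- t) W y) ts)) => [/hasP[t tin At]|hasN].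
  left; have pt := perm_to_rem tin; exists (size (rem t ts)), t; split=> //.
  - by rewrite -rE (perm_size pt).
  - exact: (allP tts).
  exists (rem t ts), qs; split=> //.
    by apply/allP => t' /mem_rem /(allP tts).
  apply: perm_trans pE; rewrite -catA perm_cat2l catA perm_cat2r perm_sym.
  exact: (perm_flatten pt).
case: (boolP (has (fun t => B < \sum_(y <- t) W y) qs)) => [/hasP[q qin Bq]|hasN'].
  right; have pq := perm_to_rem qin; exists (size (rem q qs)), q; split=> //.
  - by rewrite -sE (perm_size pq).
  - exact: (allP tqs).
  exists ts, (rem q qs); split=> //.
    by apply/allP => t' /mem_rem /(allP tqs).
  apply: perm_trans pE; rewrite -catA perm_cat2l perm_catCA perm_cat2l perm_sym.
  exact: (perm_flatten pq).
have le_A : \sum_(y <- flatten ts) W y <= r * A.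
  rewrite -rE; apply: sum_flatten => t tin; rewrite leqNgt; apply/negP => At.
  by case/negP: hasN; apply/hasP; exists t.
have le_B : \sum_(y <- flatten qs) W y <= s * B.
  rewrite -sE; apply: sum_flatten => t tin; rewrite leqNgt; apply/negP => At.
  by case/negP: hasN'; apply/hasP; exists t.
have := lt_sum; rewrite -big_enum -(perm_big _ pE) /= !big_cat /=; lia.
Qed.

Lemma degE x : \sum_y (e x y : nat) = deg e x.
Proof.
rewrite /deg -sum1_card [RHS]big_mkcond /=.
by apply: eq_bigr => y _; rewrite inE; case: (e x y).
Qed.

(** Double counting turns the weight received by all vertices into a weighted degree sum, to which
    the degree condition applies. *)
Lemma sum_wdeg I cs H :
  \sum_y wdeg I cs H y = sumn [seq x.1 * deg e (nth x0 H x.2) | x <- zip cs I].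
Proof.
rewrite /wdeg /weight.
elim: cs I => [|c cs IH] [|i I] /=; try by rewrite big1.
by rewrite big_split IH -big_distrr /= degE.
Qed.

Lemma packed_exchange h c FH FC I cs a K H C r s :
  exchange_check h c FH FC I cs a K ->
  size H = h -> edges_at H FH -> (size C == c) && edges_at C FC ->
  a < \sum_(y <- C) wdeg I cs H y -> packed r s (H ++ C) ->
  exists l Q, [/\ size l = h + c, Q \in unzip1 K, edges_at l Q & packed r s l].
Proof.
move=> chk szH FHl /andP[/eqP szC FCl] lt_a pk.
have [l [Q [pl QK Ql]]] := exchange chk szH szC FHl FCl lt_a.
exists l, Q; split=> //; last exact: packed_perm pk.
by rewrite (perm_size pl) size_cat szH szC.
Qed.

(** * Completing defective packings under the degree-sum condition *)

Variables (k : nat).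
Hypothesis sigma : sigma2_ge e (4 * k).

Lemma packed_sigma r s H i j :
  packed r s H -> i < size H -> j < size H -> i != j ->
  ~~ e (nth x0 H i) (nth x0 H j) ->
  4 * k <= deg e (nth x0 H i) + deg e (nth x0 H j).
Proof.
by move=> /packed_uniq uH iH jH ij; apply: sigma; rewrite nth_uniq.
Qed.

Lemma paw_completes r s H :
  k = r + s.+1 -> 2 * s <= r -> size H = 4 -> edges_at H paw -> packed r s H ->
  packed r s.+1 [::].
Proof.
move=> kE rs szH pH pk.
have [x1 [x2 [x3 [x4 HE]]]] : exists x1 x2 x3 x4, H = [:: x1; x2; x3; x4].
  by case: H szH {pH pk} => [|x1 [|x2 [|x3 [|x4 []]]]] // _; exists x1, x2, x3, x4.
have /and5P[e12 e13 e23 e34 _] := pH; rewrite HE /edge_at /= in e12 e13 e23 e34.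
case: (boolP (e x1 x4)) => [e14|n14].
  apply: packed_square_nil pk => //; rewrite HE /edges_at /= /edge_at /=.
  by rewrite e12 e23 e34 e_sym e14.
case: (boolP (e x2 x4)) => [e24|n24].
  apply: (@packed_square_nil _ _ [:: x2; x1; x3; x4]) => //.
    by rewrite /edges_at /= /edge_at /= e_sym e12 e13 e34 e_sym e24.
  by apply: packed_perm pk; rewrite HE; apply/permPl/(perm_catCA [:: x2] [:: x1]).
have d14 := @packed_sigma _ _ _ 0 3 pk; have d24 := @packed_sigma _ _ _ 1 3 pk.
rewrite szH HE /= n14 n24 in d14 d24.
have {}d14 := d14 isT isT isT isT; have {}d24 := d24 isT isT isT isT.
(* Both nonadjacent pairs contain [x4], whence its weight 2 and a total of at least 8k = 8r + 8s +
   8. The paw itself takes 6, and 8r + 8s + 2 > 6r + 12s since 2s <= r. *)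
case: (@packed_average (wdeg [:: 0; 1; 3] [:: 1; 1; 2] H) 6 12 _ _ _ pk).
- rewrite sum_wdeg HE unlock /= /wdeg /weight /= !e_irr !(e_sym x4).
  rewrite (negbTE n14) (negbTE n24) (e_sym x2 x1) e12 e13 e23 e34 /=; lia.
- case=> r' [t [-> tt lt_t pk']].
  have [l [Q []]] := packed_exchange paw_triangle_check szH pH tt lt_t pk'.
  move=> szl; rewrite !inE => /eqP-> Ql pl.
  have [|pl' sq] := packed_take3 _ Ql pl; first by rewrite szl.
  by apply: packed_square_nil sq pl'; rewrite size_drop szl.
case=> s' [q [-> tq lt_q pk']].
have [l [Q []]] := packed_exchange paw_square_check szH pH tq lt_q pk'.
move=> szl; rewrite !inE => /eqP-> Ql pl.
have [|pl' sq] := packed_take4 _ Ql pl; first by rewrite szl.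
by apply: packed_square_nil sq pl'; rewrite size_drop szl.
Qed.

(** Adjacent ends close a quadrilateral and any other chord makes a paw. Otherwise the two pairs at
    distance two on the path are nonadjacent and supply the degree sum. *)
Lemma path4_completes r s H :
  k = r + s.+1 -> 2 * s <= r -> size H = 4 -> edges_at H path4 ->
  packed r s H -> packed r s.+1 [::].
Proof.
move=> kE rs szH pH pk.
have [x1 [x2 [x3 [x4 HE]]]] : exists x1 x2 x3 x4, H = [:: x1; x2; x3; x4].
  by case: H szH {pH pk} => [|x1 [|x2 [|x3 [|x4 []]]]] // _; exists x1, x2, x3, x4.
have /and4P[e12 e23 e34 _] := pH; rewrite HE /edge_at /= in e12 e23 e34.
case: (boolP (e x1 x4)) => [e14|n14].
  apply: packed_square_nil pk => //; rewrite HE /edges_at /= /edge_at /=.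
  by rewrite e12 e23 e34 e_sym e14.
case: (boolP (e x1 x3)) => [e13|n13].
  apply: (paw_completes kE rs szH) pk.
  by rewrite HE /edges_at /= /edge_at /= e12 e13 e23 e34.
case: (boolP (e x2 x4)) => [e24|n24].
  apply: (@paw_completes _ _ (rev H) kE rs); first by rewrite size_rev.
    rewrite HE /edges_at /= /edge_at /= (e_sym x4 x3) (e_sym x4 x2).
    by rewrite (e_sym x3 x2) (e_sym x2 x1) e12 e23 e34 e24.
  by apply: packed_perm pk; rewrite perm_rev.
have d13 := @packed_sigma _ _ _ 0 2 pk; have d24 := @packed_sigma _ _ _ 1 3 pk.
rewrite szH HE /= n13 n24 in d13 d24.
have {}d13 := d13 isT isT isT isT; have {}d24 := d24 isT isT isT isT.
(* The total is at least 8k and the path takes 6; then 8r + 8s + 2 > 7r + 10s since 2s <= r. *)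
case: (@packed_average (wdeg [:: 0; 1; 2; 3] [:: 1; 1; 1; 1] H) 7 10 _ _ _ pk).
- rewrite sum_wdeg HE unlock /= /wdeg /weight /= !e_irr !(e_sym x4) !(e_sym x3).
  rewrite (e_sym x4 x3) (e_sym x2 x1) (negbTE n13)
    (negbTE n14) (negbTE n24) e12 e23 e34 /=.
  by lia.
- case=> r' [t [rE tt lt_t pk']].
  have [l [Q []]] := packed_exchange path4_triangle_check szH pH tt lt_t pk'.
  move=> szl; rewrite !inE => /orP[] /eqP-> Ql pl; rewrite rE in kE rs *;
    have [|pl' Hl] := packed_take3 _ Ql pl; rewrite ?szl //.
    by apply: (paw_completes kE rs) Hl pl'; rewrite size_drop szl.
  by apply: packed_square_nil Hl pl'; rewrite size_drop szl.
case=> s' [q [sE tq lt_q pk']].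
have [l [Q []]] := packed_exchange path4_square_check szH pH tq lt_q pk'.
move=> szl; rewrite !inE => /orP[] /eqP-> Ql pl; rewrite sE in kE rs *;
  have [|pl' Hl] := packed_take4 _ Ql pl; rewrite ?szl //.
  by apply: (paw_completes kE rs) Hl pl'; rewrite size_drop szl.
by apply: packed_square_nil Hl pl'; rewrite size_drop szl.
Qed.

(** Stated apart from the averaging because it serves both an original cherry and the two cherries
    found inside a bowl. *)
Lemma cherry_square_completes r s H q :
  k = r.+1 + s.+1 -> 2 * s <= r.+1 -> size H = 3 -> edges_at H cherry ->
  is_square q -> 4 < \sum_(y <- q) wdeg [:: 0; 1] [:: 1; 1] H y ->
  packed r s (H ++ q) -> packed r.+1 s.+1 [::].
Proof.
move=> kE rs szH pH tq lt_q pk.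
have [l [Q []]] := packed_exchange cherry_square_check szH pH tq lt_q pk.
move=> szl; rewrite !inE => /eqP-> Ql pl.
have [|pl' Hl] := packed_take3 _ Ql pl; first by rewrite szl.
by apply: (path4_completes kE rs) Hl pl'; rewrite size_drop szl.
Qed.

(** A cherry and a triangle with five edges between them need not split into two triangles. When
    they do not, the six vertices together contain new nonadjacent pairs, and the averaging is
    repeated with them. *)
Lemma bowl_completes r s H :
  k = r.+2 + s -> 2 * s.-1 <= r.+2 -> size H = 6 -> edges_at H bowl ->
  packed r s H -> packed r.+2 s [::].
Proof.
move=> kE rs szH pH pk.
have [x [y [z [a [b [c HE]]]]]] : exists x y z a b c, H = [:: x; y; z; a; b; c].
  case: H szH {pH pk} => [|x [|y [|z [|a [|b [|c []]]]]]] // _.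
  by exists x, y, z, a, b, c.
have : edges_at H bowl by []; rewrite HE /edges_at /= /edge_at /=.
case/and5P=> xz yz ab bc /and5P[ca xa xb xc /and3P[ya yb _]].
have closes p : perm_eq p (iota 0 6) ->
    edges_at [seq nth x0 H i | i <- p] (triangle ++ shift 3 triangle) ->
    packed r.+2 s [::].
  move=> pp Qp; have szp : size [seq nth x0 H i | i <- p] = 6.
    by rewrite size_map (perm_size pp).
  rewrite -szH in pp; have pk' := packed_perm (perm_reorder pp) pk.
  have [|pk'' Qp'] := packed_take3 _ Qp pk'; first by rewrite szp.
  by apply: packed_triangle_nil Qp' pk''; rewrite size_drop szp.
rewrite HE /edges_at /edge_at /= in closes.
(* Any one of the edges [x y], [z c], [z a], [z b] splits the bowl into two triangles. *)
case: (boolP (e x y)) => [xy|nxy].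
  by apply: (closes [:: 0; 1; 2; 3; 4; 5]); rewrite //= xy yz (e_sym z) xz ab bc ca.
case: (boolP (e z c)) => [zc|nzc].
  apply: (closes [:: 0; 5; 2; 1; 3; 4]); rewrite //=.
  by rewrite xc (e_sym c) zc (e_sym z) xz ya ab (e_sym b) yb.
case: (boolP (e z a)) => [za|nza].
  apply: (closes [:: 1; 3; 2; 0; 4; 5]); rewrite //=.
  by rewrite ya (e_sym a) za (e_sym z) yz xb bc (e_sym c) xc.
case: (boolP (e z b)) => [zb|nzb].
  apply: (closes [:: 1; 4; 2; 0; 5; 3]); rewrite //=.
  by rewrite yb (e_sym b) zb (e_sym z) yz xc ca (e_sym a) xa.
have dxy := @packed_sigma _ _ _ 0 1 pk; have dzc := @packed_sigma _ _ _ 2 5 pk.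
rewrite szH HE /= nxy nzc in dxy dzc.
have {}dxy := dxy isT isT isT isT; have {}dzc := dzc isT isT isT isT.
(* The pair [x], [y] counts once and [z], [c] twice, giving at least 12k. At most 20 stays in the
   bowl (17 without the edge [y c]), and 12k - 20 > 12(k - 2), where k - 2 is the number of other
   parts. *)
case: (@packed_average (wdeg [:: 0; 1; 2; 5] [:: 1; 1; 2; 2] H) 12 12 _ _ _ pk).
- rewrite sum_wdeg HE unlock /= /wdeg /weight /= !e_irr.
  rewrite (e_sym y x) (e_sym z x) (e_sym z y) (e_sym c x) (e_sym c y) (e_sym c z).
  rewrite (e_sym c b) (negbTE nxy) (negbTE nzc) (negbTE nza) (negbTE nzb).
  rewrite xz yz xa xb xc ya yb ca bc.
  by move: kE dxy dzc; clear; case: (e y c) => /=; lia.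
- case=> r' [t [rE tt lt_t pk']].
  have [l [Q []]] := packed_exchange bowl_triangle_check szH pH tt lt_t pk'.
  move=> szl; rewrite !inE => /eqP-> Ql pl; rewrite rE.
  have [|pl' Ql'] := packed_take3 _ Ql pl; first by rewrite szl.
  have [|pl'' Ql''] := packed_take3 _ Ql' pl'; first by rewrite size_drop szl.
  by apply: packed_triangle_nil Ql'' pl''; rewrite !size_drop szl.
case=> s' [q [sE tq lt_q pk']]; rewrite sE in kE rs *.
(* Since the first sum plus twice the second exceeds 12, one of them exceeds 4. Accordingly the bowl
   is cut into the cherry [x z y] and triangle [a b c], or the cherry [z x c] and triangle
   [y a b]. *)
have [xy_q|zc_q] : 4 < \sum_(u <- q) wdeg [:: 0; 1] [:: 1; 1] [:: x; y; z] u \/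
    4 < \sum_(u <- q) wdeg [:: 0; 1] [:: 1; 1] [:: z; c; x] u.
- have : \sum_(u <- q) wdeg [:: 0; 1; 2; 5] [:: 1; 1; 2; 2] H u =
    \sum_(u <- q) wdeg [:: 0; 1] [:: 1; 1] [:: x; y; z] u +
    2 * \sum_(u <- q) wdeg [:: 0; 1] [:: 1; 1] [:: z; c; x] u.
    rewrite big_distrr -big_split; apply: eq_bigr => u _.
    by rewrite HE /wdeg /weight /= !mul1n !addn0 mulnDr addnA.
  by move: lt_q; clear; lia.
- apply: (cherry_square_completes kE rs _ _ tq xy_q) => //.
    by rewrite /edges_at /= /edge_at /= xz yz.
  apply: (@packed_triangle _ _ [:: a; b; c]).
    by rewrite /is_triangle /edges_at /= /edge_at /= ab bc ca.
  by apply: packed_perm pk'; rewrite HE /= perm_sym;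
    apply/permPl/(perm_catCA [:: x; y; z] [:: a; b; c]).
apply: (cherry_square_completes kE rs _ _ tq zc_q) => //.
  by rewrite /edges_at /= /edge_at /= e_sym xz e_sym xc.
apply: (@packed_triangle _ _ [:: y; a; b]).
  by rewrite /is_triangle /edges_at /= /edge_at /= ya ab e_sym yb.
apply: packed_perm pk'; rewrite catA perm_cat2r.
by rewrite HE (perm_reorder (p := [:: 1; 3; 4; 2; 5; 0])
  (l := [:: x; y; z; a; b; c])).
Qed.

Lemma cherry_completes r s H :
  k = r.+1 + s.+1 -> 2 * s <= r.+1 -> size H = 3 -> edges_at H cherry ->
  packed r s.+1 H -> packed r.+1 s.+1 [::].
Proof.
move=> kE rs szH pH pk.
have [x [y [z HE]]] : exists x y z, H = [:: x; y; z].
  by case: H szH {pH pk} => [|x [|y [|z []]]] // _; exists x, y, z.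
have /and3P[xz yz _] := pH; rewrite HE /edge_at /= in xz yz.
case: (boolP (e x y)) => [xy|nxy].
  apply: packed_triangle_nil pk => //; rewrite HE /edges_at /= /edge_at /=.
  by rewrite xy yz e_sym xz.
have dxy := @packed_sigma _ _ _ 0 1 pk; rewrite szH HE /= nxy in dxy.
have {}dxy := dxy isT isT isT isT.
(* Only 2 of the at least 4k edge ends go to the centre, and 4k - 2 > 4(k - 1) with k - 1 other
   parts. *)
case: (@packed_average (wdeg [:: 0; 1] [:: 1; 1] H) 4 4 _ _ _ pk).
- rewrite sum_wdeg HE unlock /= /wdeg /weight /= !e_irr (e_sym y x) (negbTE nxy).
  by rewrite xz yz /=; lia.
- case=> r' [t [rE tt lt_t pk']]; rewrite rE in kE rs *.
  have [l [Q []]] := packed_exchange cherry_triangle_check szH pH tt lt_t pk'.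
  move=> szl; rewrite !inE => /eqP-> Ql pl.
  by apply: bowl_completes szl Ql pl => //=.
case=> s' [q [[<-] tq lt_q pk']].
exact: cherry_square_completes pk'.
Qed.
End Graph.

(** * Complete graphs, the base of the induction *)

Section Complete.

Variables (T : finType) (e : rel T) (x0 : T).
Hypothesis complete : forall x y, x != y -> e x y.

Lemma complete_edges_at l P :
  uniq l -> bounded (size l) P -> all (fun ij => ij.1 != ij.2) P ->
  edges_at e x0 l P.
Proof.
move=> ul /allP bP /allP nP; apply/allP => ij ijP.
by have /andP[i1 i2] := bP _ ijP; apply: complete; rewrite nth_uniq // nP.
Qed.

Lemma complete_packed_rec r s a b H :
  size H = 3 * a + 4 * b -> packed e x0 r s H ->
  packed e x0 (r + a) (s + b) [::].
Proof.
have bounded_le m n P : m <= n -> bounded m P -> bounded n P.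
  move=> le_mn; apply: sub_all => ij /andP[i1 i2].
  by rewrite !(leq_trans _ le_mn).
elim: a r H => [|a IHa] r H szH pk; last first.
  rewrite addnS -addSn; apply: (IHa _ (drop 3 H)); first by rewrite size_drop; lia.
  apply: (@packed_triangle _ _ _ _ _ (take 3 H)); last by rewrite cat_take_drop.
  rewrite /is_triangle size_takel ?edges_at_take //; last by lia.
  apply: complete_edges_at (packed_uniq pk) _ _ => //.
  by apply: (@bounded_le 3 _ triangle _ isT); rewrite szH; lia.
rewrite addn0; elim: b s H szH pk => [|b IHb] s H szH pk.
  by rewrite addn0; move/eqP: szH pk => /nilP->.
rewrite addnS -addSn; apply: (IHb _ (drop 4 H)); first by rewrite size_drop; lia.
apply: (@packed_square _ _ _ _ _ (take 4 H)); last by rewrite cat_take_drop.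
rewrite /is_square size_takel ?edges_at_take //; last by lia.
apply: complete_edges_at (packed_uniq pk) _ _ => //.
by apply: (@bounded_le 4 _ square _ isT); rewrite szH; lia.
Qed.

Lemma complete_packed r s : #|T| = 3 * r + 4 * s -> packed e x0 r s [::].
Proof.
rewrite cardE => szT; apply: (complete_packed_rec (r := 0) (s := 0) szT).
by exists [::], [::]; split; rewrite //= cats0.
Qed.

End Complete.

(** * Adding a nonedge and removing it from a packing *)

Definition add_edge (T : finType) (e : rel T) (x y : T) : rel T :=
  fun u v => [|| e u v, (u == x) && (v == y) | (u == y) && (v == x)].

Section AddEdge.

Variables (T : finType) (e : rel T) (x0 x y : T).
Hypotheses (e_sym : symmetric e) (neq_xy : x != y).
Let e' := add_edge e x y.

Lemma add_edge_sym : symmetric e'.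
Proof.
move=> u v; rewrite /e' /add_edge e_sym; congr (_ || _).
by rewrite orbC ![(v == _) && _]andbC.
Qed.

Lemma add_edge_irr : irreflexive e -> irreflexive e'.
Proof.
move=> e_irr u; rewrite /e' /add_edge e_irr.
by case: (u =P x) => [->|_]; rewrite ?(negbTE neq_xy) ?andbF.
Qed.

(** Degrees only grow, and pairs nonadjacent afterwards were nonadjacent before. *)
Lemma add_edge_sigma n : sigma2_ge e n -> sigma2_ge e' n.
Proof.
move=> sigma u v uv; rewrite negb_or => /andP[nuv _].
have le_deg w : deg e w <= deg e' w.
  by apply/subset_leq_card/subsetP => z; rewrite !inE /e' /add_edge => ->.
exact: leq_trans (sigma _ _ uv nuv) (leq_add _ _).
Qed.

Lemma add_edge_avoid u v : u != x -> v != x -> e' u v -> e u v.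
Proof.
by rewrite /e' /add_edge => /negbTE-> /negbTE->; rewrite andbF !orbF.
Qed.

Lemma add_edge_from v : v != y -> e' x v -> e x v.
Proof.
by rewrite /e' /add_edge => /negbTE->; rewrite (negbTE neq_xy) andbF !orbF.
Qed.

Lemma avoid_triangle t :
  x \notin t -> is_triangle e' x0 t -> is_triangle e x0 t.
Proof.
move=> xt /andP[/eqP szt /allP tt]; rewrite /is_triangle szt; apply/allP => ij ijP.
have /allP/(_ _ ijP)/andP[i1 i2] : bounded 3 triangle by [].
apply: add_edge_avoid (tt _ ijP); apply: contraNneq xt => <-;
  by rewrite mem_nth // szt.
Qed.

Lemma avoid_square q : x \notin q -> is_square e' x0 q -> is_square e x0 q.
Proof.
move=> xt /andP[/eqP szt /allP tt]; rewrite /is_square szt; apply/allP => ij ijP.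
have /allP/(_ _ ijP)/andP[i1 i2] : bounded 4 square by [].
apply: add_edge_avoid (tt _ ijP); apply: contraNneq xt => <-;
  by rewrite mem_nth // szt.
Qed.

(* All parts but the one through [x] avoid the new edge. *)
Lemma packed_around r s : packed e' x0 r s [::] ->
  (exists r' t, [/\ r = r'.+1, x \in t, is_triangle e' x0 t
                  & packed e x0 r' s t]) \/
  (exists s' q, [/\ s = s'.+1, x \in q, is_square e' x0 q
                  & packed e x0 r s' q]).
Proof.
case=> ts [qs [rE sE /allP tts /allP tqs pE]]; rewrite cat0s in pE.
have avoid t (us vs : seq (seq T)) :
    x \in t -> perm_eq (t ++ flatten us ++ flatten vs) (enum T) ->
    x \notin flatten us /\ x \notin flatten vs.
  move=> xt /perm_uniq; rewrite enum_uniq cat_uniq => /and3P[_ /hasPn nt _].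
  by split; apply/negP => xus; have := nt x; rewrite mem_cat xus ?orbT xt => /(_ isT).
have notin (us : seq (seq T)) t : x \notin flatten us -> t \in us -> x \notin t.
  by move=> nx tus; apply: contra nx => xt; apply/flattenP; exists t.
have : x \in flatten ts ++ flatten qs by rewrite (perm_mem pE) mem_enum.
rewrite mem_cat => /orP[] /flattenP[t tin xt]; [left | right];
  have pt := perm_to_rem tin.
- have {}pE : perm_eq (t ++ flatten (rem t ts) ++ flatten qs) (enum T).
    apply: perm_trans pE; rewrite catA perm_cat2r perm_sym.
    exact: (perm_flatten pt).
  have [nts nqs] := avoid _ _ _ xt pE.
  exists (size (rem t ts)), t; split; rewrite ?tts -?rE ?(perm_size pt) //.
  exists (rem t ts), qs; split=> //; apply/allP => u uin.
    by apply: avoid_triangle (notin _ _ nts uin) (tts _ (mem_rem uin)).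
  by apply: avoid_square (notin _ _ nqs uin) (tqs _ uin).
have {}pE : perm_eq (t ++ flatten ts ++ flatten (rem t qs)) (enum T).
  apply: perm_trans pE; rewrite perm_catCA perm_cat2l perm_sym.
  exact: (perm_flatten pt).
have [nts nqs] := avoid _ _ _ xt pE.
exists (size (rem t qs)), t; split; rewrite ?tqs -?sE ?(perm_size pt) //.
exists ts, (rem t qs); split=> //; apply/allP => u uin.
  by apply: avoid_triangle (notin _ _ nts uin) (tts _ uin).
by apply: avoid_square (notin _ _ nqs uin) (tqs _ (mem_rem uin)).
Qed.

(** Rotate the triangle to start at [x]. If it uses the new edge, then [y] is a neighbour of [x] on
    it, and deleting that edge leaves a cherry centred at the third vertex. *)
Lemma add_edge_triangle r s t :
  x \in t -> is_triangle e' x0 t -> packed e x0 r s t ->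
  packed e x0 r.+1 s [::] \/
  exists2 H, size H = 3 & edges_at e x0 H cherry /\ packed e x0 r s H.
Proof.
move=> xt /andP[/eqP szt tt] pk.
have [u [v [pt xu uv vx]]] : exists u v,
    [/\ perm_eq [:: x; u; v] t, e' x u, e' u v & e' v x].
  case: t szt xt tt {pk} => [|a [|b [|c []]]] // _; rewrite !inE.
  move=> xabc /and4P[ab bc ca _]; rewrite /edge_at /= in ab bc ca.
  case/or3P: xabc => /eqP->; [exists b, c | exists c, a | exists a, b]; split=> //.
    by rewrite (perm_catC [:: b; c] [:: a]).
  by rewrite (perm_catC [:: c] [:: a; b]).
have {}pk := packed_perm pt pk.
have := packed_uniq pk; rewrite /= !inE negb_or => /and3P[/andP[nxu nxv] nuv _].
rewrite eq_sym in nxu; rewrite eq_sym in nxv.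
have {}uv := add_edge_avoid nxu nxv uv; rewrite add_edge_sym in vx.
have [uy|nuy] := eqVneq u y; last have [vy|nvy] := eqVneq v y.
- right; exists [:: x; u; v] => //; split=> //.
  by rewrite /edges_at /= /edge_at /= uv (add_edge_from _ vx) // -uy eq_sym.
- right; exists [:: x; v; u] => //; split.
    by rewrite /edges_at /= /edge_at /= (e_sym v u) uv (add_edge_from nuy xu).
  by apply: packed_perm pk; rewrite perm_cons; apply/permPl/(perm_catC [:: v] [:: u]).
left; apply: packed_triangle_nil pk => //.
rewrite /edges_at /= /edge_at /= uv (add_edge_from nuy xu) (e_sym v x).
by rewrite (add_edge_from nvy vx).
Qed.

(** The new edge is used only if [y] is next to [x] on the cycle, and deleting it leaves a path on
    the same four vertices. If [y] is opposite to [x], the cycle already lies in the old graph. *)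
Lemma add_edge_square r s q :
  x \in q -> is_square e' x0 q -> packed e x0 r s q ->
  packed e x0 r s.+1 [::] \/
  exists2 H, size H = 4 & edges_at e x0 H path4 /\ packed e x0 r s H.
Proof.
move=> xq /andP[/eqP szq tq] pk.
have [u [v [w [pt xu uv vw wx]]]] : exists u v w,
    [/\ perm_eq [:: x; u; v; w] q, e' x u, e' u v, e' v w & e' w x].
  case: q szq xq tq {pk} => [|a [|b [|c [|d []]]]] // _; rewrite !inE.
  move=> xabc /and5P[ab bc cd da _]; rewrite /edge_at /= in ab bc cd da.
  case/or4P: xabc => /eqP->; [exists b, c, d | exists c, d, a
    | exists d, a, b | exists a, b, c]; split=> //.
  - by rewrite (perm_catC [:: b; c; d] [:: a]).
  - by rewrite (perm_catC [:: c; d] [:: a; b]).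
  by rewrite (perm_catC [:: d] [:: a; b; c]).
have {}pk := packed_perm pt pk.
have := packed_uniq pk; rewrite /= !inE !negb_or.
case/and4P=> /and3P[nxu nxv nxw] /andP[nuv nuw] nvw _.
rewrite eq_sym in nxu; rewrite eq_sym in nxv; rewrite eq_sym in nxw.
have {}uv := add_edge_avoid nxu nxv uv; have {}vw := add_edge_avoid nxv nxw vw.
rewrite add_edge_sym in wx.
have [uy|nuy] := eqVneq u y; last have [wy|nwy] := eqVneq w y.
- right; exists [:: u; v; w; x] => //; split.
    by rewrite /edges_at /= /edge_at /= uv vw (e_sym w x)
      (add_edge_from _ wx) // -uy eq_sym.
  by apply: packed_perm pk; apply/permPl/(perm_catC [:: u; v; w] [:: x]).
- right; exists [:: x; u; v; w] => //; split=> //.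
  by rewrite /edges_at /= /edge_at /= uv vw (add_edge_from nuy xu).
left; apply: packed_square_nil pk => //.
rewrite /edges_at /= /edge_at /= uv vw (add_edge_from nuy xu) (e_sym w x).
by rewrite (add_edge_from nwy wx).
Qed.

End AddEdge.

(** * Induction on the number of nonedges *)

Lemma sigma_packed (T : finType) (e : rel T) (x0 : T) r s :
  symmetric e -> irreflexive e -> sigma2_ge e (4 * (r.+1 + s.+1)) ->
  2 * s <= r.+1 -> #|T| = 3 * r.+1 + 4 * s.+1 -> packed e x0 r.+1 s.+1 [::].
Proof.
move=> + + + rs cT.
(* The count takes ordered pairs and includes the diagonal; it still drops strictly, as the added
   edge removes the pair [(x, y)]. *)
have [m] := ubnP #|[set p : T * T | ~~ e p.1 p.2]|.
elim: m e => // m IHm e lt_m e_sym e_irr sigma.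
case: (boolP [exists p : T * T, (p.1 != p.2) && ~~ e p.1 p.2]); last first.
  rewrite negb_exists => /forallP cpl; apply: complete_packed cT => x y nxy.
  by have := cpl (x, y); rewrite /= nxy /= negbK.
case/existsP=> -[x y] /= /andP[nxy exy].
have pk' : packed (add_edge e x y) x0 r.+1 s.+1 [::].
  apply: IHm; [|exact: add_edge_sym|exact: add_edge_irr|exact: add_edge_sigma].
  rewrite -ltnS; apply: leq_trans lt_m; rewrite ltnS; apply: proper_card.
  apply/properP; split.
    by apply/subsetP => p; rewrite !inE /add_edge negb_or => /andP[].
  by exists (x, y); rewrite !inE //= /add_edge !eqxx orbT.
case: (packed_around pk') => [[r' [t [[<-] xt tt pk]]]|[s' [q [[<-] xq tq pk]]]].
  case: (add_edge_triangle e_sym nxy xt tt pk) => // -[H szH [HP pH]].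
  exact: (cherry_completes e_sym e_irr sigma erefl rs szH HP pH).
case: (add_edge_square e_sym nxy xq tq pk) => // -[H szH [HP pH]].
exact: (path4_completes e_sym e_irr sigma erefl rs szH HP pH).
Qed.

(** * From packings to labelled disjoint cycles *)

Lemma nth_flatten_uniform (T : Type) (x0 : T) c (ls : seq (seq T)) i j :
  all (fun l => size l == c) ls -> i < size ls -> j < c ->
  nth x0 (flatten ls) (i * c + j) = nth x0 (nth [::] ls i) j.
Proof.
move=> + + jc; elim: ls i => [|l ls IH] [|i] //= /andP[/eqP szl sz] lti.
  by rewrite nth_cat szl jc.
rewrite nth_cat szl mulSn -addnA ltnNge leq_addr /= addKn; exact: IH.
Qed.

(** Concatenating all cycles gives a duplicate-free list, so reading it at distinct positions gives
    distinct vertices, and injectivity becomes arithmetic on [pos]. *)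
Lemma packed_contains (T : finType) (e : rel T) (x0 : T) r s :
  packed e x0 r s [::] -> contains_rC3_sC4 e r s.
Proof.
case=> ts [qs [rE sE /allP tts /allP tqs pE]]; rewrite cat0s in pE.
have sz3 : all (fun l : seq T => size l == 3) ts by apply/allP => t /tts /andP[].
have sz4 : all (fun l : seq T => size l == 4) qs by apply/allP => t /tqs /andP[].
have size_fl c (ls : seq (seq T)) :
    all (fun l => size l == c) ls -> size (flatten ls) = size ls * c.
  by elim: ls => //= l ls IH /andP[/eqP szl /IH szls]; rewrite size_cat szl szls mulSn.
pose f (a : 'I_r * 'I_3 + 'I_s * 'I_4) : T :=
  match a with
  | inl (i, j) => nth x0 (nth [::] ts i) j
  | inr (i, j) => nth x0 (nth [::] qs i) j
  end.
pose pos (a : 'I_r * 'I_3 + 'I_s * 'I_4) : nat :=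
  match a with
  | inl (i, j) => i * 3 + j
  | inr (i, j) => r * 3 + (i * 4 + j)
  end.
have szL : size (flatten ts ++ flatten qs) = r * 3 + s * 4.
  by rewrite size_cat (size_fl 3) ?(size_fl 4) // rE sE.
have posL a : pos a < size (flatten ts ++ flatten qs).
  rewrite szL; case: a => -[i j] /=; have := ltn_ord i; have := ltn_ord j; lia.
have fE a : f a = nth x0 (flatten ts ++ flatten qs) (pos a).
  rewrite nth_cat (size_fl 3) // rE; case: a => -[i j] /=.
    have -> : i * 3 + j < r * 3 by have := ltn_ord i; have := ltn_ord j; lia.
    by rewrite nth_flatten_uniform ?rE.
  by rewrite ltnNge leq_addr /= addKn nth_flatten_uniform ?sE.
have pos_inj : injective pos.
  case=> -[i j] [] [i' j'] /=;
    have := ltn_ord i; have := ltn_ord j; have := ltn_ord i'; have := ltn_ord j'.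
  - by move=> *; congr (inl (_, _)); apply: val_inj => /=; lia.
  - by lia.
  - by lia.
  by move=> *; congr (inr (_, _)); apply: val_inj => /=; lia.
exists f; split; [|split].
- move=> a b; rewrite !fE => /eqP; rewrite nth_uniq ?posL //.
    by move/eqP/pos_inj.
  by rewrite (perm_uniq pE) enum_uniq.
- move=> i j; have /tts/andP[_] : nth [::] ts i \in ts by rewrite mem_nth ?rE.
  (* The pattern lists its edges cyclically, so entry [j] joins [j] to [ordS j], wrap-around
     included. *)
  by case/and4P=> e0 e1 e2 _; case: j => -[|[|[|]]].
move=> i j; have /tqs/andP[_] : nth [::] qs i \in qs by rewrite mem_nth ?sE.
by case/and5P=> e0 e1 e2 e3 _; case: j => -[|[|[|[|]]]].
Qed.

Theorem theorem2 (r s : nat) (T : finType) (e : rel T) :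
  0 < r -> 0 < s -> 2 * s - 2 <= r ->
  simple_graph e ->
  #|T| = 3 * r + 4 * s ->
  sigma2_ge e (#|T| + r) ->
  contains_rC3_sC4 e r s.
Proof.
case: r s => [|r] [|s] // _ _ rs [e_sym e_irr] cT sigma.
have /card_gt0P[x0 _] : 0 < #|T| by lia.
apply: (@packed_contains _ _ x0); apply: sigma_packed => //; last by lia.
(* With n = 3r + 4s, the bound n + r is exactly 4(r + s). *)
by have -> : 4 * (r.+1 + s.+1) = #|T| + r.+1 by lia.
Qed.
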